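(* Let $H,G$ be finitely generated groups. Then $H$ admits a translation-like action on $G$ if and only if there exists a free $G$-chart $(X,\gamma)$ of $H$, with $X$ a nonempty $G$-subshift.
   Context: Groups are discrete. For a countable group $G$ and a finite set $\Sigma$, $\Sigma^G$ carries the product topology and the left action $(gx)(h)=x(hg)$. A $G$-subshift is a closed $G$-invariant subset of $\Sigma^G$ for some finite $\Sigma$. Let $X$ be a $G$-subshift. An $H$-cocycle is a continuous map $\gamma\colon H\times X\to G$ with $\gamma(1_H,x)=1_G$ and $\gamma(h_1h_2,x)=\gamma(h_1,\gamma(h_2,x)x)\,\gamma(h_2,x)$ for all $h_1,h_2\in H$, $x\in X$. For each $x\in X$ it induces a left action of $H$ on the set $G$ by $h\cdot_x g=\gamma(h,gx)g$. The pair $(X,\gamma)$ is called a $G$-chart of $H$; it is a free $G$-chart if for every $x\in X$ the action $\cdot_x$ of $H$ on $G$ is free (that is, $h\cdot_x g=g$ for some $g$ implies $h=1_H$). An action of $H$ on a metric space $(M,d)$ is translation-like if it is free ($hm=m$ for some $m$ implies $h=1_H$) and bounded ($\sup_{m\in M}d(m,hm)<\infty$ for each $h\in H$). A finitely generated group $G$ is viewed as a metric space via a word metric, in the convention for which boundedness means: for each $h\in H$ the set $\{(h\cdot g)g^{-1}: g\in G\}$ is finite. *)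

(* Defs.v *)
From HB Require Import structures.
From mathcomp Require Import all_boot all_order all_algebra.
From mathcomp Require Import all_classical all_reals all_analysis.

Set Implicit Arguments.
Unset Strict Implicit.
Unset Printing Implicit Defensive.

Import Order.TTheory GRing.Theory Num.Theory.

Local Open Scope classical_set_scope.
Local Open Scope group_scope.

Section Words.
Variable G : groupType.
Implicit Types (S w : seq G) (g : G) (n : nat).

Definition is_word S w : bool := all (fun s => (s \in S) || (s^-1 \in S)) w.

Definition word_prod w : G := \prod_(s <- w) s.

Definition spelled_in S n g : Prop :=
  exists w, [/\ is_word S w, size w = n & word_prod w = g].

Definition generates S : Prop :=
  forall g, exists2 w, is_word S w & word_prod w = g.

Definition finitely_generated : Prop := exists S, generates S.

Lemma generates_spelled S : generates S ->
  forall g, exists n, `[< spelled_in S n g >].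
Proof.
by move=> gS g; have [w Sw wg] := gS g; exists (size w); apply/asboolP; exists w.
Qed.

Definition word_length S (gS : generates S) g : nat :=
  ex_minn (generates_spelled gS g).

Lemma word_lengthP S (gS : generates S) g : spelled_in S (word_length gS g) g.
Proof. by rewrite /word_length; case: ex_minnP => n /asboolP. Qed.

Lemma word_length_le S (gS : generates S) n g :
  spelled_in S n g -> (word_length gS g <= n)%N.
Proof.
by rewrite /word_length; case: ex_minnP => m _ + /asboolP ng => /(_ n ng).
Qed.

Lemma spelled_in0 S g : spelled_in S 0 g <-> g = 1.
Proof.
split=> [[w [_ /size0nil -> <-]]|->]; first by rewrite /word_prod big_nil.
by exists [::]; rewrite /word_prod big_nil.
Qed.

Lemma spelled_inM S m n g h :
  spelled_in S m g -> spelled_in S n h -> spelled_in S (m + n) (g * h).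
Proof.
move=> [v [Sv <- <-]] [w [Sw <- <-]]; exists (v ++ w).
by rewrite /is_word all_cat size_cat /word_prod big_cat/=; split=> //; apply/andP.
Qed.

Lemma spelled_inV S n g : spelled_in S n g -> spelled_in S n g^-1.
Proof.
move=> [w [Sw <- <-]] {n g}; elim: w Sw => [_|s w IH].
  by rewrite /word_prod big_nil invg1; apply/spelled_in0.
rewrite /is_word /= => /andP[Ss /IH Sw].
rewrite /word_prod big_cons invgM -addn1; apply: spelled_inM => //.
exists [:: s^-1]; rewrite /is_word /word_prod big_seq1 /= invgK andbT.
by rewrite orbC.
Qed.

Lemma spelled_in_finite S n : finite_set [set g | spelled_in S n g].
Proof.
elim: n => [|n IH].
  by apply: (sub_finite_set _ (finite_set1 (1 : G))) => g /= /spelled_in0.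
pose L := [set` S ++ [seq s^-1 | s <- S]].
have fL : finite_set L by exact: finite_seq.
apply: (sub_finite_set _ (finite_image2 (fun s g : G => s * g) fL IH)).
move=> h [[|s w] []] //; rewrite /is_word /= => /andP[Ss Sw] [wn] <-.
exists s.
  rewrite /L /= mem_cat; case/orP: Ss => [->//|Ss].
  by apply/orP; right; apply/mapP; exists s^-1; rewrite ?invgK.
by exists (word_prod w); [exists w | rewrite /word_prod big_cons].
Qed.

End Words.

(* The distance from g to g' is the length of g' * g^-1, so that it is
   right-invariant and left multiplication moves points a bounded distance. *)
Definition word_dist (R : realType) (G : groupType) (S : seq G)
    (gS : generates S) (g g' : G) : R :=
  ((word_length gS (g' * g^-1))%:R)%R.

Section WordDist.
Variables (R : realType) (G : groupType) (S : seq G) (gS : generates S).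
Local Notation d := (word_dist R gS).

Lemma word_dist_refl g : d g g = 0%R.
Proof.
have /word_length_le : spelled_in S 0 (g * g^-1).
  by apply/spelled_in0; rewrite mulgV.
by move=> /(_ gS); rewrite leqn0 /word_dist => /eqP ->.
Qed.

Lemma word_dist_eq0 g g' : d g g' = 0%R -> g = g'.
Proof.
rewrite /word_dist => /eqP; rewrite pnatr_eq0 => /eqP l0.
have := word_lengthP gS (g' * g^-1); rewrite l0 => /spelled_in0 e.
by rewrite -[g']mulg1 -(mulVg g) mulgA e mul1g.
Qed.

Lemma word_dist_sym g g' : d g g' = d g' g.
Proof.
suff le h h' : (word_length gS (h' * h^-1) <= word_length gS (h * h'^-1))%N.
  by congr (_%:R)%R; apply/eqP; rewrite eqn_leq !le.
apply: word_length_le; rewrite -[h' * h^-1]invgK invgM invgK.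
exact/spelled_inV/word_lengthP.
Qed.

Lemma word_dist_triangle g' g g'' : (d g g'' <= d g g' + d g' g'')%R.
Proof.
rewrite /word_dist -natrD ler_nat addnC; apply: word_length_le.
have -> : g'' * g^-1 = (g'' * g'^-1) * (g' * g^-1) by rewrite divgKA.
by apply: spelled_inM; exact: word_lengthP.
Qed.

End WordDist.

Definition word_space (R : realType) (G : groupType) (S : seq G)
  (gS : generates S) : Type := G.

HB.instance Definition _ (R : realType) (G : groupType) (S : seq G)
    (gS : generates S) :=
  Choice.copy (word_space R gS) G.

HB.instance Definition _ (R : realType) (G : groupType) (S : seq G)
    (gS : generates S) :=
  isMetric.Build R (word_space R gS) (@word_dist_refl R G S gS)
    (@word_dist_eq0 R G S gS) (@word_dist_sym R G S gS)
    (@word_dist_triangle R G S gS).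

Section Actions.
Variable H : groupType.

Definition is_left_action (M : Type) (act : H -> M -> M) : Prop :=
  (forall m, act 1 m = m) /\
  (forall h1 h2 m, act (h1 * h2) m = act h1 (act h2 m)).

Definition free_action (M : Type) (act : H -> M -> M) : Prop :=
  forall h m, act h m = m -> h = 1.

Definition bounded_action (R : realType) (M : metricType R)
    (act : H -> M -> M) : Prop :=
  forall h, has_ubound [set mdist m (act h m) | m in [set: M]].

Definition translation_like (R : realType) (M : metricType R)
    (act : H -> M -> M) : Prop :=
  [/\ is_left_action act, free_action act & bounded_action act].

Definition admits_translation_like (R : realType) (M : metricType R) : Prop :=
  exists act : H -> M -> M, translation_like act.

End Actions.

Lemma word_space_boundedE (R : realType) (H G : groupType) (S : seq G)
    (gS : generates S) (act : H -> G -> G) :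
  bounded_action (act : H -> word_space R gS -> word_space R gS) <->
  forall h, finite_set [set act h g * g^-1 | g in [set: G]].
Proof.
split=> bact h; last first.
  have /finite_seqP[D DE] := bact h.
  exists ((\max_(x <- D) word_length gS x)%:R)%R => _ [g _ <-].
  rewrite [leLHS]/(word_dist _ _ _ _) ler_nat.
  apply: (@leq_bigmax_seq _ D xpredT (word_length gS)) => //.
  by have : [set` D] (act h g * g^-1) by rewrite -DE; exists g.
have [C Cub] := bact h.
pose n := (Num.truncn C).+1.
apply: (@sub_finite_set _ _ (\bigcup_(k in `I_n) [set g | spelled_in S k g])).
  move=> _ [g _ <-]; exists (word_length gS (act h g * g^-1)).
    rewrite /= -(ltr_nat R) (le_lt_trans _ (truncnS_gt C))//.
    by apply: Cub; exists g.
  exact: word_lengthP.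
by apply: bigcup_finite => // k _; exact: spelled_in_finite.
Qed.

Section Subshifts.
Variables (G : groupType) (A : finType).

Definition full_shift : Type := {ptws G -> discrete_topology A}.

HB.instance Definition _ :=
  Topological.copy full_shift {ptws G -> discrete_topology A}.

Definition shift (g : G) (x : full_shift) : full_shift := fun h => x (h * g).

Definition is_subshift (X : set full_shift) : Prop :=
  closed X /\ forall g x, X x -> X (shift g x).

End Subshifts.

Section Charts.
Variables (H G : groupType) (A : finType).
Implicit Types (X : set (full_shift G A)) (gamma : H -> full_shift G A -> G).

(* Only the values of gamma on H x X matter; outside X they are junk. *)
Definition is_cocycle X gamma : Prop :=
  [/\ {within [set: discrete_topology H] `*` X,
        continuous (fun p : discrete_topology H * full_shift G A =>
          (gamma p.1 p.2 : discrete_topology G))},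
      forall x, X x -> gamma 1 x = 1 &
      forall h1 h2 x, X x ->
        gamma (h1 * h2) x = gamma h1 (shift (gamma h2 x) x) * gamma h2 x].

Definition is_chart X gamma : Prop := is_subshift X /\ is_cocycle X gamma.

Definition chart_act gamma (x : full_shift G A) (h : H) (g : G) : G :=
  gamma h (shift g x) * g.

Definition is_free_chart X gamma : Prop :=
  is_chart X gamma /\ forall x, X x -> free_action (chart_act gamma x).

Lemma chart_act_is_left_action X gamma x :
  is_chart X gamma -> X x -> is_left_action (chart_act gamma x).
Proof.
move=> [[_ shX] [_ g1 gM]] Xx; split=> [g|h1 h2 g]; rewrite /chart_act.
  by rewrite g1 ?mul1g//; exact: shX.
rewrite gM; last exact: shX.
rewrite -mulgA; congr (gamma h1 _ * _).
by apply: funext => k; rewrite /shift mulgA.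
Qed.

End Charts.

(* Main.v *)
(* A free chart yields, at any configuration of X, the action induced by the
   cocycle; it is bounded because gamma h is continuous on the compact space X
   with values in a discrete space, hence takes finitely many values.
   Conversely, a bounded action is encoded by the configuration whose symbol at
   g lists, for the generators t of H, the displacements (t g) g^-1; these take
   finitely many values, so the alphabet is finite. The configurations for which following generators defines a free
   H-action on G, i.e. for which two words with the same value lead from g to
   the same place and a word with nontrivial value never fixes a point, form a
   nonempty subshift X, and gamma h x is the place reached from 1 by following
   a word for h in x. *)
Require Import Defs.
From mathcomp Require Import all_boot all_order all_algebra.
From mathcomp Require Import all_classical all_reals all_analysis.

(* [all_analysis] hides the [shift] of [Defs]. *)
Import Defs.

Set Implicit Arguments.
Unset Strict Implicit.
Unset Printing Implicit Defensive.

Local Open Scope classical_set_scope.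
Local Open Scope group_scope.

Lemma discrete_compact_finite (T : discreteTopologicalType) (K : set T) :
  compact K -> finite_set K.
Proof.
move=> cK; apply: contrapT => infK.
(* Sets containing all but finitely many points of [K]: for infinite [K] this filter is proper, yet
   it contains the complement of each point, so it cannot cluster. *)
pose F : set_system T := [set B | finite_set (K `\` B)].
have FF : ProperFilter F.
  split; first by rewrite /F /= setD0.
  split=> [|B C|B C BC]; rewrite /F /=.
  - by rewrite setDT.
  - by rewrite setDIr finite_setU.
  - by apply: sub_finite_set => x [Kx nCx]; split=> // /BC.
have [|p [_ clp]] := cK F FF; first by rewrite /F /= setDv.
have Fp : F [set~ p].
  by apply: (sub_finite_set _ (finite_set1 p)) => x [_ /contrapT].
by have [x [/= np px]] := clp _ _ Fp (discrete_set1 p).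
Qed.

Lemma locally_constant_cvg (T : Type) (U : choiceType) (F : set_system T)
    (f : T -> discrete_topology U) (u : discrete_topology U) :
  Filter F -> (\forall x \near F, f x = u) -> f @ F --> u.
Proof. by move=> FF fu; apply/discrete_cvg. Qed.

Section FullShift.
Variables (G : groupType) (A : finType).

Lemma full_shift_compact : compact [set: full_shift G A].
Proof.
have cA (g : G) : compact [set: discrete_topology A].
  exact/finite_compact/finite_finset.
rewrite (_ : setT = [set f : full_shift G A | forall g : G,
  [set: discrete_topology A] (f g)]); last by apply/seteqP; split.
exact: (@tychonoff G (fun=> discrete_topology A) (fun=> setT) cA).
Qed.

Lemma near_eval (x : full_shift G A) (g : G) :
  \forall y \near x, y g = x g.
Proof.
exact: (@proj_continuous G (fun=> discrete_topology A) g x _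
  (@discrete_set1 (discrete_topology A) (x g))).
Qed.

End FullShift.

Lemma cocycle_finite_range (H G : groupType) (A : finType)
    (X : set (full_shift G A)) gamma h :
  is_chart X gamma -> finite_set (gamma (h : H) @` X).
Proof.
move=> [[clX _] [cg _ _]].
apply: (@discrete_compact_finite (discrete_topology G)).
have cX : compact X.
  exact: (subclosed_compact clX (@full_shift_compact G A)).
apply: continuous_compact cX; apply/subspace_continuousP => x Xx.
apply: locally_constant_cvg.
(* Continuity at [(h, x)] gives a rectangle [P] times [Q]; its slice at [h] is the required
   neighbourhood of [x]. *)
have /subspace_continuousP/(_ (h, x)) := cg.
move=> /(_ (conj I Xx))/discrete_cvg [[P Q] /= [Ph Qx] PQ].
apply: filterS Qx => y Qy Xy.
apply: (PQ (h, y)) => //; split => //=.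
exact: nbhs_singleton Ph.
Qed.

Section Walks.
Variables (G : groupType) (L : finType) (D : seq G).
Local Notation A := {ffun L -> seq_sub D}.
Implicit Types (x : full_shift G A) (w : seq L) (g k : G).

Definition walk x w g : G :=
  foldr (fun l k => ssval ((x k : A) l) * k) g w.

Lemma walk_cat x v w g : walk x (v ++ w) g = walk x v (walk x w g).
Proof. exact: foldr_cat. Qed.

(** Displacements multiply on the left, so they commute with right translation by [k]. *)
Lemma walk_shift x w g k : walk (shift k x) w g * k = walk x w (g * k).
Proof. by elim: w => //= l w IH; rewrite -mulgA IH /shift IH. Qed.

Lemma near_walk x w g : \forall y \near x, walk y w g = walk x w g.
Proof.
elim: w => [|l w IH] /=; first by apply: filterE.
by apply: filterS2 IH (near_eval x (walk x w g)) => y -> ->.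
Qed.

Variables (H : groupType) (e : L -> H) (spell : H -> seq L).
Local Notation value w := (\prod_(l <- w) e l).

Definition walk_actions : set (full_shift G A) :=
  [set x | (forall v w g, value v = value w -> walk x v g = walk x w g) /\
           (forall w g, walk x w g = g -> value w = 1)].

(** For fixed words and starting point, each condition reads only finitely many symbols, hence
    passes to the closure. *)
Lemma walk_actions_subshift : is_subshift walk_actions.
Proof.
split=> [x clx|k x [xE xF]]; last first.
  split=> [v w g vw|w g wg].
    by apply: (mulIg k); rewrite !walk_shift; exact: xE.
  by apply: (xF w (g * k)); rewrite -walk_shift wg.
split=> [v w g vw|w g wg].
  have [y [[yE _] [<- <-]]] :=
    clx _ (filterI (near_walk x v g) (near_walk x w g)).
  exact: yE.
have [y [[_ yF] /= yw]] := clx _ (near_walk x w g).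
by apply: (yF w g); rewrite yw.
Qed.

Definition walk_cocycle (h : H) (x : full_shift G A) : G := walk x (spell h) 1.

Hypothesis spellK : forall h, value (spell h) = h.

Lemma walk_free_chart : is_free_chart walk_actions walk_cocycle.
Proof.
split; [split; first exact: walk_actions_subshift; split|].
- apply/subspace_continuousP => -[h x] _; apply: locally_constant_cvg.
  apply: (@cvg_within _ (nbhs ((h : discrete_topology H), x))).
  exists ([set h], [set y | walk y (spell h) 1 = walk x (spell h) 1]).
    split; [exact: (@discrete_set1 (discrete_topology H))|exact: near_walk].
  by move=> [h' y] /= [-> yx].
- by move=> x [xE _]; rewrite /walk_cocycle (xE _ [::]) // spellK big_nil.
- move=> h1 h2 x [xE _]; rewrite /walk_cocycle walk_shift mul1g -walk_cat.
  by apply: xE; rewrite big_cat /= !spellK.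
- move=> x [_ xF] h g; rewrite /chart_act /walk_cocycle walk_shift mul1g.
  by move=> /xF; rewrite spellK.
Qed.

Lemma walk_actions_nonempty (act : H -> G -> G) :
  is_left_action act -> free_action act ->
  (forall l g, act (e l) g * g^-1 \in D) -> walk_actions !=set0.
Proof.
move=> [act1 actM] actF actD.
pose x : full_shift G A := fun g => [ffun l => SeqSub (actD l g)].
have xE w g : walk x w g = act (value w) g.
  elim: w => [|l w IH] /=; first by rewrite big_nil act1.
  by rewrite IH ffunE /= mulgVK big_cons actM.
exists x; split=> [v w g vw|w g]; rewrite !xE ?vw //.
exact: actF.
Qed.

End Walks.

(** Inverses of generators become letters of their own, so a word is a plain product of letters. *)
Lemma generates_spell (H : groupType) : finitely_generated H ->
  exists (L : finType) (e : L -> H) (spell : H -> seq L),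
    forall h, \prod_(l <- spell h) e l = h.
Proof.
move=> [T gT]; pose U := T ++ [seq t^-1 | t <- T].
exists (seq_sub U), (@ssval _ U).
suff /choice [spell spellK] :
  forall h : H, exists w : seq (seq_sub U), \prod_(l <- w) ssval l = h.
  by exists spell.
move=> h; have [w + <-] := gT h; elim: w => [_|t w IH /= /andP[Tt /IH[v vw]]].
  by exists [::]; rewrite /word_prod !big_nil.
have Ut : t \in U.
  rewrite mem_cat; case/orP: Tt => [->//|Tt].
  by apply/orP; right; apply/mapP; exists t^-1; rewrite ?invgK.
by exists (SeqSub Ut :: v); rewrite /word_prod !big_cons vw.
Qed.

Theorem proposition3p22 (R : realType) (H G : groupType)
    (fgH : finitely_generated H) (S : seq G) (gS : generates S) :
  admits_translation_like H (word_space R gS) <->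
  exists (A : finType) (X : set (full_shift G A))
         (gamma : H -> full_shift G A -> G),
    (X !=set0)%classic /\ is_free_chart X gamma.
Proof.
split=> [[act [actA actF /word_space_boundedE actB]]|].
  have [L [e [spell spellK]]] := generates_spell fgH.
  have /finite_seqP[D DE] : finite_set
      (\bigcup_(l : L) [set act (e l) g * g^-1 | g in [set: G]]).
    by apply: bigcup_finite => // l _; exact: actB.
  have actD l g : act (e l) g * g^-1 \in D.
    suff : [set` D] (act (e l) g * g^-1) by [].
    by rewrite -DE; exists l => //; exists g.
  exists {ffun L -> seq_sub D}, (walk_actions e), (walk_cocycle spell).
  by split; [exact: walk_actions_nonempty actD|exact: walk_free_chart].
move=> [A [X [gamma [[x Xx] [chX freeX]]]]].
exists (chart_act gamma x); split.
- exact: chart_act_is_left_action chX Xx.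
- exact: freeX.
- apply/word_space_boundedE => h.
  apply: sub_finite_set (cocycle_finite_range h chX) => _ [g _ <-].
  (* The displacement at [g] is the value of [gamma h] at a translate of [x], which stays in [X]. *)
  exists (shift g x); last by rewrite /chart_act mulgK.
  by have [[_ shX] _] := chX; exact: shX.
Qed.
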